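(* Let $n\ge 1$ be an integer. There is a polynomial $p_{n-2}(r)$ in $r$ (depending on $n$) of degree no more than $n-2$ such that for every integer $r\ge 1$, $$\mathcal{D}(L_n,r)\ge\frac{(n-1)!\,\lceil \log_2(2n+1)\rceil}{2^{n+1}r^{n-1} + p_{n-2}(r)}.$$
   Context: $L_n$ denotes the $n$-dimensional lattice graph: its vertex set is $\mathbb{Z}^n$, and $\{(x_1,\ldots,x_n),(y_1,\ldots,y_n)\}$ is an edge if and only if $\sum_{i=1}^n |x_i-y_i|=1$. For a connected undirected graph $G$ with graph distance $d$, put $B_r(v)=\{u\in V(G): d(u,v)\le r\}$. A code is a nonempty subset $C\subseteq V(G)$. A code $C$ is $r$-identifying if (1) $B_r(v)\cap C\neq\emptyset$ for all $v\in V(G)$, and (2) $B_r(u)\cap C\ne B_r(v)\cap C$ for all $u\neq v$ in $V(G)$. The density of a code $C$ in $L_n$ is $\limsup_{m\to\infty} |C\cap Q_m|/|Q_m|$, where $Q_m$ is the set of $(x_1,\ldots,x_n)\in\mathbb{Z}^n$ with $|x_i|\le m$ for all $i$. $\mathcal{D}(L_n,r)$ denotes the minimum possible density (the infimum over all $r$-identifying codes) of an $r$-identifying code for $L_n$. A polynomial of degree no more than $-1$ means the zero polynomial. *)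

(* Defs.v *)
From HB Require Import structures.
From mathcomp Require Import all_boot all_order all_algebra finmap.
From mathcomp Require Import all_classical all_reals all_analysis.

Set Implicit Arguments.
Unset Strict Implicit.
Unset Printing Implicit Defensive.

Import Order.TTheory GRing.Theory Num.Theory.

Local Open Scope classical_set_scope.
Local Open Scope ring_scope.

Record connGraph := ConnGraph {
  vertex :> choiceType;
  adj : rel vertex;
  adj_sym : symmetric adj;
  adj_irr : irreflexive adj;
  adj_conn : forall u v : vertex, exists p, path adj u p /\ last u p = v }.

Section GraphDistance.
Variable G : connGraph.
Implicit Types (u v : G) (r k : nat) (C : set G).

Definition has_walk u v k : Prop :=
  exists p, [/\ path (@adj G) u p, last u p = v & size p = k].

Fact ex_walk u v : exists k, `[< has_walk u v k >].
Proof.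
by have [p [pP pv]] := adj_conn u v; exists (size p); apply/asboolP; exists p.
Qed.

Definition gdist u v : nat := ex_minn (ex_walk u v).

Definition gball r v : set G := [set u | (gdist u v <= r)%N].

Definition is_code C : Prop := C !=set0.

Definition identifying r C : Prop :=
  [/\ is_code C,
      forall v, gball r v `&` C !=set0
    & forall u v, u <> v -> gball r u `&` C <> gball r v `&` C].

End GraphDistance.

Section Lattice.
Variable n : nat.
Implicit Types x y : 'rV[int]_n.

Definition lattice_adj x y : bool := \sum_(i < n) `|x 0 i - y 0 i| == 1.

Fact lattice_adj_sym : symmetric lattice_adj.
Proof.
by move=> x y; rewrite /lattice_adj; congr (_ == _); apply: eq_bigr => i _; rewrite distrC.
Qed.

Fact lattice_adj_irr : irreflexive lattice_adj.
Proof. by move=> x; rewrite /lattice_adj big1 // => i _; rewrite subrr normr0. Qed.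

Fact lattice_adj_conn x y :
  exists p, path lattice_adj x p /\ last x p = y.
Proof.
have [k] := ubnP (absz (\sum_(i < n) `|x 0 i - y 0 i|)).
elim: k x => // k IHk x; rewrite ltnS => le_k.
have [->|neq_xy] := eqVneq x y; first by exists [::].
have /existsP[i xyi] : [exists i, x 0 i != y 0 i].
  apply: contraNT neq_xy => /existsPn xy; apply/eqP/rowP => i.
  by have := xy i; rewrite negbK => /eqP.
have yxi : y 0 i - x 0 i != 0 by rewrite subr_eq0 eq_sym.
pose z := x + Num.sg (y 0 i - x 0 i) *: delta_mx 0 i.
have zi : z 0 i = x 0 i + Num.sg (y 0 i - x 0 i).
  by rewrite !mxE !eqxx mulr1.
have zj j : j != i -> z 0 j = x 0 j.
  by move=> /negPf ji; rewrite !mxE eqxx ji mulr0 addr0.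
have xz : lattice_adj x z.
  rewrite /lattice_adj (bigD1 i) //= big1 => [|j ji]; last by rewrite zj // subrr normr0.
  by rewrite zi opprD addNKr addr0 normrN normr_sg yxi.
have zyE : `|z 0 i - y 0 i| = `|x 0 i - y 0 i| - 1.
  rewrite zi -[LHS]normrN opprB opprD addrA [in RHS]distrC.
  set d := y 0 i - x 0 i in yxi *.
  rewrite {1}[d]numEsg -{2}[Num.sg d]mulr1 -mulrBr normrM normr_sg yxi mul1r.
  by rewrite ger0_norm // subr_ge0 -gtz0_ge1 normr_gt0.
have [|p [pP pv]] := IHk z; last by exists (z :: p); rewrite /= xz.
apply: leq_trans le_k; rewrite -ltz_nat !gez0_abs ?sumr_ge0 //.
rewrite (bigD1 i) //= [ltRHS](bigD1 i) //= zyE.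
rewrite (eq_bigr (fun j => `|x 0 j - y 0 j|)) => [|j ji]; last by rewrite zj.
by rewrite ltrD2r ltrBlDr ltrDl.
Qed.

Definition lattice : connGraph :=
  ConnGraph lattice_adj_sym lattice_adj_irr lattice_adj_conn.

Definition cube (m : nat) : set 'rV[int]_n :=
  [set x | forall i, `|x 0 i| <= m%:Z].

(* fset_set sends infinite sets to fset0; both sets below are finite, being
   contained in a cube. *)
Definition density (R : realType) (C : set 'rV[int]_n) : \bar R :=
  limn_esup (fun m : nat =>
    ((#|` fset_set (C `&` cube m)|%:R / #|` fset_set (cube m)|%:R : R)%:E)).

(* The density is [0, 1]-valued, so that the infimum in \bar R is the usual
   real infimum. *)
Definition min_density (R : realType) (r : nat) : \bar R :=
  ereal_inf [set density R C | C in @identifying lattice r].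

End Lattice.

(* Main.v *)
(* A vertex v and its 2n neighbours have the same trace of C outside the annulus
   of points w with r <= |w - v|_1 <= r + 1, as closer points lie in all 2n + 1
   balls and farther ones in none. So C separates them only if it has at least
   log2 (2n + 1) points in that annulus, and double counting over large cubes
   bounds the density of C below by ceil (log2 (2n + 1)) over the size of the
   annulus. Writing a point of norm k as signs times a composition of k into n
   parts bounds that size by 2^n ('C(n-1+r, n-1) + 'C(n+r, n-1)), which is
   1 / (n-1)! times a polynomial in r with leading term 2^(n+1) r^(n-1). *)
Require Import Defs.
From HB Require Import structures.
From mathcomp Require Import all_boot all_order all_algebra finmap.
From mathcomp Require Import all_classical all_reals all_analysis.
From mathcomp Require Import zify ring.

Set Implicit Arguments.
Unset Strict Implicit.
Unset Printing Implicit Defensive.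

Import Order.TTheory GRing.Theory Num.Theory numFieldNormedType.Exports.

Local Open Scope classical_set_scope.
Local Open Scope ring_scope.

(** * Graph distance in the lattice is the l1 distance *)

Definition l1 n (x : 'rV[int]_n) : nat := (\sum_(i < n) absz (x 0%R i))%N.

Lemma l1D n (x y : 'rV[int]_n) : (l1 (x + y) <= l1 x + l1 y)%N.
Proof. by rewrite -big_split; apply: leq_sum => i _; rewrite mxE /=; lia. Qed.

Lemma l1N n (x : 'rV[int]_n) : l1 (- x) = l1 x.
Proof. by apply: eq_bigr => i _; rewrite mxE abszN. Qed.

Lemma l1_eq0 n (x : 'rV[int]_n) : l1 x = 0%N -> x = 0.
Proof.
move=> /eqP; rewrite sum_nat_eq0 => /forallP x0; apply/rowP => i.
by have := x0 i; rewrite mxE /= absz_eq0 => /eqP.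
Qed.

Lemma l1_delta n (b : bool) (i : 'I_n) : l1 ((-1) ^+ b *: delta_mx 0 i) = 1%N.
Proof.
rewrite /l1 (bigD1 i) //= big1 => [|j /negPf ji]; rewrite !mxE ?eqxx ?ji ?mulr0 //.
by case: b.
Qed.

Lemma lattice_adjE n (x y : 'rV[int]_n) : lattice_adj x y = (l1 (x - y) == 1%N).
Proof.
rewrite /lattice_adj /l1 -eqz_nat (big_morph Posz PoszD (erefl _)).
by congr (_ == _); apply: eq_bigr => i _; rewrite !mxE.
Qed.

Lemma lattice_walk n (x y : lattice n) : has_walk x y (l1 (x - y)).
Proof.
have [k dxy] : exists k, l1 (x - y) = k by exists (l1 (x - y)).
rewrite dxy; elim: k => [|k IHk] in x dxy *.
  by move/l1_eq0/eqP: dxy; rewrite subr_eq0 => /eqP ->; exists [::].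
have /existsP[i xyi] : [exists i, x 0 i != y 0 i].
  apply: contraPT dxy => /existsPn xy; rewrite /l1 big1 // => i _.
  by have := xy i; rewrite negbK !mxE => /eqP ->; rewrite subrr.
pose z : 'rV[int]_n := x + (-1) ^+ (y 0 i < x 0 i)%R *: delta_mx 0 i.
have zj j : j != i -> z 0 j = x 0 j.
  by move=> /negPf ji; rewrite !mxE eqxx ji mulr0 addr0.
have xz : lattice_adj x z.
  by rewrite lattice_adjE opprD addNKr l1N l1_delta.
have [|p [pP pv sp]] := IHk z; last first.
  by exists (z :: p); split; rewrite /= ?xz ?sp.
move: dxy; rewrite /l1 (bigD1 i) //= => dxy; rewrite (bigD1 i) //=.
have -> : (\sum_(j < n | j != i) absz ((z - y)%R 0%R j) =
           \sum_(j < n | j != i) absz ((x - y)%R 0%R j))%N.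
  by apply: eq_bigr => j ji; rewrite [in LHS]mxE zj ?mxE.
move: dxy; set S := (\sum_(_ < _ | _) _)%N; rewrite !mxE !eqxx mulr1.
by case: ltrgtP xyi => //= yx _; rewrite ?expr1 ?expr0; lia.
Qed.

(** The explicit walk bounds the distance above; the triangle inequality along an arbitrary walk
    bounds it below. *)
Lemma gdistE n (x y : 'rV[int]_n) : @gdist (lattice n) x y = l1 (x - y).
Proof.
rewrite /gdist; case: ex_minnP => k /asboolP[p [pP pv <-]] kmin.
apply/eqP; rewrite eqn_leq kmin ?andTb; last exact/asboolP/lattice_walk.
elim: p => [|z p IHp] /= in x pP pv {kmin} *.
  by rewrite pv subrr /l1 big1 // => i; rewrite mxE.
have /andP[] := pP; rewrite lattice_adjE => /eqP xz zp.
rewrite -[x](subrK z) -addrA; apply: leq_trans (l1D _ _) _.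
by rewrite xz; apply: IHp.
Qed.

(** * Encoding spheres and the annulus by signed weak compositions *)

Definition composition d k :=
  {t : d.+1.-tuple 'I_k.+1 | (\sum_(i <- t) i == k)%N}.

Lemma card_composition d k : #|{: composition d k}| = 'C(d + k, d).
Proof. by rewrite card_sig -cardsE card_ord_partitions. Qed.

(* The encoding is not injective: zero entries carry an irrelevant sign. Only an
   upper bound on the size of the sphere is needed. *)
Definition signed_row d k (c : {ffun 'I_d.+1 -> bool} * composition d k) :
  'rV[int]_d.+1 := \row_i ((-1) ^+ (c.1 i) * (tnth (val c.2) i)%:Z).

Lemma signed_row_le d k (c : {ffun 'I_d.+1 -> bool} * composition d k) i :
  `|signed_row c 0 i| <= k%:Z.
Proof.
rewrite mxE normrM normrX normrN1 expr1n mul1r ger0_norm // lez_nat.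
by rewrite -ltnS ltn_ord.
Qed.

Lemma signed_row_onto d (w : 'rV[int]_d.+1) :
  exists c : {ffun 'I_d.+1 -> bool} * composition d (l1 w), signed_row c = w.
Proof.
have wS i : (absz (w 0%R i) < (l1 w).+1)%N by rewrite ltnS /l1 (bigD1 i) //= leq_addr.
pose t := [tuple Ordinal (wS i) | i < d.+1].
have tw : (\sum_(i <- t) i == l1 w)%N.
  rewrite big_tuple; apply/eqP; apply: eq_bigr => i _.
  by rewrite tnth_mktuple.
exists ([ffun i => w 0 i < 0], exist _ t tw); apply/rowP => i.
by rewrite mxE /= ffunE tnth_mktuple /= abszE mulr_sign_norm.
Qed.

Definition annulus d r : Type :=
  ({ffun 'I_d.+1 -> bool} * composition d r +
   {ffun 'I_d.+1 -> bool} * composition d r.+1)%type.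

Definition annulus_row d r (c : annulus d r) : 'rV[int]_d.+1 :=
  match c with inl c => signed_row c | inr c => signed_row c end.

Lemma card_annulus d r :
  #|{: annulus d r}| = (2 ^ d.+1 * ('C(d + r, d) + 'C(d + r.+1, d)))%N.
Proof.
rewrite card_sum !card_prod !card_composition card_ffun card_bool card_ord.
by rewrite mulnDr.
Qed.

Lemma annulus_row_le d r (c : annulus d r) i : `|annulus_row c 0 i| <= r.+1%:Z.
Proof.
case: c => c; last exact: signed_row_le.
by apply: le_trans (signed_row_le c i) _; rewrite lez_nat.
Qed.

Lemma annulus_row_onto d r (w : 'rV[int]_d.+1) :
  (r <= l1 w <= r.+1)%N -> exists c : annulus d r, annulus_row c = w.
Proof.
have [c cw] := signed_row_onto w; move=> rw.
have {rw} /orP[/eqP wr|/eqP wr] : (l1 w == r) || (l1 w == r.+1) by lia.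
  by rewrite wr in c cw; exists (inl c).
by rewrite wr in c cw; exists (inr c).
Qed.

(** * Code points in the annulus around a vertex *)

Definition hits n (C : set 'rV[int]_n) (I : finType) (f : I -> 'rV[int]_n)
  (v : 'rV[int]_n) : {set I} := [set i | `[< C (v + f i) >]]%SET.

Lemma identifying_hits n r (C : set 'rV[int]_n) (I : finType)
    (f : I -> 'rV[int]_n) (v : 'rV[int]_n) :
  (forall w, (r <= l1 w <= r.+1)%N -> exists i, f i = w) ->
  @identifying (lattice n) r C -> (2 * n + 1 <= 2 ^ #|hits C f v|)%N.
Proof.
(* [e] lists the closed unit ball around the origin, with [None] as its centre. The trace of [C] on
   the ball around [v + e o] is recorded by [F o], a subset of the hits, so injectivity of [F] puts
   [2 * n + 1] sets in a power set. *)
move=> f_onto [_ _ sepC].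
pose e (o : option ('I_n * bool)) : 'rV[int]_n :=
  if o is Some (i, b) then (-1) ^+ b *: delta_mx 0 i else 0.
have e_inj : injective e.
  have e0 i b : e (Some (i, b)) != 0.
    by apply/eqP => /(congr1 (@l1 n)) /=; rewrite l1_delta /l1 big1 // => j _; rewrite mxE.
  move=> [[i b]|] [[j c]|] //; last 2 first.
  - by move/eqP; rewrite (negPf (e0 i b)).
  - by move/esym/eqP; rewrite (negPf (e0 j c)).
  move=> /= /rowP /(_ i); rewrite !mxE !eqxx /=.
  by have [->|] := eqVneq i j; case: b; case: c.
have e_le1 o : (l1 (e o) <= 1)%N.
  by case: o => [[i b]|]; rewrite ?l1_delta // /l1 big1 // => i; rewrite mxE.
pose F o := [set i in hits C f v | l1 (v + f i - (v + e o)) <= r]%N%SET.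
have F_inj : injective F.
  move=> o o' Foo'; apply: contrapT => neq_oo'.
  apply: (sepC (v + e o) (v + e o')); first by move=> /addrI/e_inj.
  suff sub p q (x : 'rV[int]_n) : F p = F q -> C x ->
      (l1 (x - (v + e p)) <= r)%N -> (l1 (x - (v + e q)) <= r)%N.
    apply/seteqP; split=> x [/=]; rewrite /gball /= !gdistE => px Cx;
      by split=> //; apply: (sub _ _ _ _ Cx px).
  have [w ->] : exists w, x = v + w by exists (x - v); rewrite addrC subrK.
  move=> Fpq Cx; have vw o1 : v + w - (v + e o1) = w - e o1.
    by rewrite opprD addrACA subrr add0r.
  rewrite !vw => pw.
  have wpw : (l1 w <= l1 (w - e p) + l1 (e p))%N.
    by rewrite -[X in (l1 X <= _)%N](subrK (e p) w); apply: l1D.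
  have qw : (l1 (w - e q) <= l1 w + l1 (e q))%N by rewrite -[l1 (e q)]l1N; apply: l1D.
  (* A point at distance less than [r] from [v] lies in every ball. Otherwise [pw] forces
     [l1 w <= r.+1], so [w] is some [f i] and [Fpq] decides its membership. *)
  have [rw|rw] := ltnP (l1 w) r; first by have := e_le1 q; lia.
  have [|i fi] := f_onto w; first by have := e_le1 p; lia.
  by move/setP: Fpq => /(_ i); rewrite !inE !fi !vw pw (asboolT Cx).
have cardF : #|[set F o | o in [set: option ('I_n * bool)]%SET]%SET| = (2 * n + 1)%N.
  by rewrite card_imset // cardsT card_option card_prod card_ord card_bool; lia.
rewrite -cardF -card_powerset; apply: subset_leq_card.
apply/fintype.subsetP => _ /imsetP[p _ ->]; rewrite powersetE.
by apply/fintype.subsetP => i; rewrite inE => /andP[].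
Qed.

Lemma ceil_log2_le (R : realType) (a b : nat) : (0 < a)%N -> (a <= 2 ^ b)%N ->
  Num.ceil (ln (a%:R : R) / ln 2) <= b%:Z.
Proof.
move=> a_gt0 ab; have ln2 : 0 < ln (2 : R) by rewrite ln_gt0 // ltr1n.
rewrite ceil_le_int ler_pdivrMr // mulrC -[b%:Z%:~R]/(b%:R) mulr_natr -lnXn //.
by rewrite ler_ln ?posrE ?exprn_gt0 ?ltr0n // -natrX ler_nat.
Qed.

(** * Enumeration of cubes and double counting *)

Definition cube_row n m (t : {ffun 'I_n -> 'I_(2 * m).+1}) : 'rV[int]_n :=
  \row_i ((t i)%:Z - m%:Z).

Lemma cube_row_inj n m : injective (@cube_row n m).
Proof.
move=> s t /rowP st; apply/ffunP => i; apply/val_inj.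
by have := st i; rewrite !mxE => /addIr[].
Qed.

Lemma cube_row_le n m (t : {ffun 'I_n -> 'I_(2 * m).+1}) i :
  `|cube_row t 0 i| <= m%:Z.
Proof. by rewrite mxE; have := ltn_ord (t i); lia. Qed.

Lemma fset_cube n m :
  fset_set (@cube n m) = [fset cube_row t | t : {ffun 'I_n -> 'I_(2 * m).+1}]%fset
  /\ finite_set (@cube n m).
Proof.
suff cubeE : cube m = [set` [fset cube_row t | t : {ffun 'I_n -> 'I_(2 * m).+1}]%fset].
  by split; rewrite cubeE ?set_fsetK //; apply: finite_fset.
apply/seteqP; split => [x xm|x /imfsetP[t _ ->] i]; last exact: cube_row_le.
have xS i : (absz (x 0%R i + m%:Z)%R < (2 * m).+1)%N by have := xm i; lia.
apply/imfsetP; exists [ffun i => Ordinal (xS i)] => //; apply/rowP => i.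
by rewrite mxE ffunE /=; have := xm i; lia.
Qed.

Lemma finite_cube n m : finite_set (@cube n m).
Proof. by have [] := fset_cube n m. Qed.

Lemma card_cube n m : #|` fset_set (@cube n m)| = ((2 * m).+1 ^ n)%N.
Proof.
have [-> _] := fset_cube n m.
rewrite card_imfset; last exact: cube_row_inj.
by rewrite -cardE card_ffun !card_ord.
Qed.

(** Exchange the sums: for a fixed index [i], translation by [f i] is injective and sends the
    centres that it counts to code points of the cube enlarged by [B]. *)
Lemma sum_hits_le n m B (C : set 'rV[int]_n) (I : finType)
    (f : I -> 'rV[int]_n) :
  (forall i j, `|f i 0 j| <= B%:Z) ->
  (\sum_(t : {ffun 'I_n -> 'I_(2 * m).+1}) #|hits C f (cube_row t)|
   <= #|I| * #|` fset_set (C `&` cube (m + B))|)%N.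
Proof.
move=> f_le; under eq_bigr => t _ do rewrite -sum1dep_card.
rewrite (exchange_big_dep predT) //= -sum_nat_const.
apply: leq_sum => i _; rewrite sum1dep_card.
have finC : finite_set (C `&` cube (m + B)) by apply: finite_setIr; exact: finite_cube.
set T := [set t | _]%SET.
have inj : injective (fun t : {ffun 'I_n -> 'I_(2 * m).+1} => cube_row t + f i).
  by move=> s t /addIr /cube_row_inj.
have -> : #|T| = #|` [fset (cube_row t + f i)%R | t in T]%fset|.
  by rewrite card_imfset //= cardE.
apply: fsubset_leq_card; apply/fsubsetP => x /imfsetP[t /=]; rewrite inE => /asboolP Ct ->.
rewrite in_fset_set // inE; split=> // j; rewrite mxE.
by rewrite PoszD (le_trans (ler_normD _ _)) ?lerD ?cube_row_le.
Qed.

(** * Passing to the limit in the density *)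

Lemma limn_esup_ge (R : realType) (u w : (\bar R)^nat) (l : \bar R) N :
  (forall m, (N <= m)%N -> w m <= u m)%E -> w @ \oo --> l ->
  (l <= limn_esup u)%E.
Proof.
move=> wu wl; have [_ <-] := cvg_limn_einf_sup wl.
rewrite !limn_esup_lim; apply: lee_lim; [exact: is_cvg_esups..|].
near=> k; apply: ge_ereal_sup => _ [m /= km <-].
apply: le_trans (wu _ _) _; last by apply: ereal_sup_ubound; exists m.
by apply: leq_trans km; near: k; exact: nbhs_infty_ge.
Unshelve. all: by end_near. Qed.

Lemma cvg_cube_ratio (R : realType) n B :
  ((2 * m).+1 ^ n)%:R / ((2 * (m + B)).+1 ^ n)%:R @[m --> \oo] --> (1 : R).
Proof.
under eq_fun => m do rewrite !natrX -expr_div_n.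
suff ratio : (2 * m).+1%:R / (2 * (m + B)).+1%:R @[m --> \oo] --> (1 : R).
  by have := cvg_comp _ _ ratio (@exprn_continuous R n 1); rewrite expr1n.
(* The defect from 1 is a constant times a reciprocal squeezed between 0 and the harmonic
   sequence. *)
have ratioE m : (2 * m).+1%:R / (2 * (m + B)).+1%:R =
    1 - (2 * B)%:R * (2 * (m + B)).+1%:R^-1 :> R.
  apply: (mulIf (_ : (2 * (m + B)).+1%:R != 0)); first by rewrite pnatr_eq0.
  rewrite mulrBl !divfK ?pnatr_eq0 // mul1r -natrB; last by lia.
  by congr (_%:R); lia.
under eq_fun => m do rewrite ratioE.
suff : 1 - (2 * B)%:R * (2 * (m + B)).+1%:R^-1 @[m --> \oo] --> (1 - (2 * B)%:R * 0 : R).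
  by rewrite mulr0 subr0.
apply: cvgB; first exact: cvg_cst.
apply: cvgM; first exact: cvg_cst.
apply: (@squeeze_cvgr _ _ _ _ (fun=> 0) (@harmonic R)); [|exact: cvg_cst|exact: cvg_harmonic].
near=> m; rewrite invr_ge0 ler0n /=.
by rewrite lef_pV2 ?posrE ?ltr0n // ler_nat; lia.
Unshelve. all: by end_near. Qed.

Lemma density_ge (R : realType) d r (C : set 'rV[int]_d.+1) (K : nat) :
  (forall v, (K <= #|hits C (@annulus_row d r) v|)%N) ->
  ((K%:R / (2 ^ d.+1 * ('C(d + r, d) + 'C(d + r.+1, d)))%:R : R)%:E
     <= density R C)%E.
Proof.
move=> hitsK; set N := (_ * (_ + _))%N.
have N_gt0 : 0 < N%:R :> R.
  by rewrite ltr0n muln_gt0 expn_gt0 addn_gt0 bin_gt0 leq_addr.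
(* Centres range over the cube of radius [m - r.+1], so that their annuli stay in [cube m]; the
   comparison starts at [m = r.+1], where the truncated subtraction is exact. *)
pose w (m : nat) : R :=
  K%:R / N%:R * (((2 * (m - r.+1)).+1 ^ d.+1)%:R / ((2 * m).+1 ^ d.+1)%:R).
apply: (@limn_esup_ge _ _ (EFin \o w) _ r.+1) => [m rm|]; last first.
  apply: cvg_EFin; first exact: nearW.
  rewrite -[K%:R / _]mulr1; apply: cvgM; first exact: cvg_cst.
  rewrite -(cvg_shiftn r.+1) /=.
  by under eq_fun => m do rewrite addnK; exact: cvg_cube_ratio.
rewrite lee_fin /w card_cube mulrA ler_pM2r ?invr_gt0 ?ltr0n ?expn_gt0 //.
rewrite mulrAC ler_pdivrMr // -!natrM ler_nat mulnC [leqRHS]mulnC.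
have := sum_hits_le (m - r.+1) C (@annulus_row_le d r).
rewrite subnK // card_annulus; apply: leq_trans.
have -> : ((2 * (m - r.+1)).+1 ^ d.+1 = #|{ffun 'I_d.+1 -> 'I_(2 * (m - r.+1)).+1}|)%N.
  by rewrite card_ffun !card_ord.
by rewrite -sum_nat_const; apply: leq_sum.
Qed.

(** * Binomial coefficients as polynomials in the radius *)

Definition rising (R : nzRingType) d c : {poly R} :=
  \prod_(i < d) ('X - (- (c.+1 + i)%:R)%:P).

Lemma horner_rising (R : comNzRingType) d c k :
  (rising R d c).[k%:R] = ('C(d + (k + c), d) * d`!)%:R :> R.
Proof.
(* The falling factorial lists its factors from the largest down, [rising] from the smallest up;
   hence the reversal. *)
rewrite bin_ffact ffact_prod natr_prod horner_prod (reindex_inj rev_ord_inj).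
apply: eq_bigr => i _; rewrite !hornerE opprK -natrD /=.
by congr (_%:R); have := ltn_ord i; lia.
Qed.

Lemma size_monic_subXn (R : nzRingType) (q : {poly R}) d :
  q \is monic -> size q = d.+1 -> (size (q - 'X^d)%R <= d)%N.
Proof.
move=> /monicP qm qs; apply/leq_sizeP => j; rewrite leq_eqVlt => /orP[/eqP <-|dj].
  by move: qm; rewrite lead_coefE qs coefB coefXn eqxx => ->; rewrite subrr.
by rewrite coefB coefXn gtn_eqF // subr0 nth_default // qs.
Qed.

Lemma size_rising_subXn (R : nzRingType) d c : (size (rising R d c - 'X^d)%R <= d)%N.
Proof.
apply: size_monic_subXn; first exact: monic_prod_XsubC.
by rewrite size_prod_XsubC /index_enum unlock -enumT size_enum_ord.
Qed.

Theorem theorem5 (R : realType) (n : nat) (n_ge1 : (1 <= n)%N) :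
  exists p : {poly R},
    (size p <= n.-1)%N /\
    forall r : nat, (1 <= r)%N ->
      let denom : R := 2 ^+ n.+1 * r%:R ^+ n.-1 + p.[r%:R] in
      0 < denom /\
      ((((n.-1)`!%:R * (Num.ceil (ln ((2 * n + 1)%:R : R) / ln 2))%:~R / denom)%:E
        <= min_density n R r)%E).
Proof.
case: n n_ge1 => // d _; set q := fun c => rising R d c - 'X^d.
(* [d!] times the annulus bound is [2 ^ d.+1] times the values at [r] of [rising R d 0] and
   [rising R d 1] added together. Both are monic of degree [d], so their leading terms give
   [2 ^ d.+2 * r ^ d] and the witness is the remainder. Size at most [d] means degree at most
   [n - 2], and zero when [n = 1]. *)
exists (2 ^+ d.+1 *: (q 0%N + q 1%N)); split.
  apply: leq_trans (size_scale_leq _ _) _; apply: leq_trans (size_polyD _ _) _.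
  by rewrite geq_max !size_rising_subXn.
move=> r r_ge1 denom; set N := (2 ^ d.+1 * ('C(d + r, d) + 'C(d + r.+1, d)))%N.
have denomE : denom = d`!%:R * N%:R.
  rewrite /denom /q hornerZ !(hornerD, hornerN, hornerXn) !horner_rising.
  rewrite addn0 addn1 /N !natrM natrX natrD.
  by rewrite exprS /=; ring.
have d_gt0 : 0 < d`!%:R :> R by rewrite ltr0n fact_gt0.
rewrite denomE; split.
  by rewrite mulr_gt0 // ltr0n muln_gt0 expn_gt0 addn_gt0 bin_gt0 leq_addr.
rewrite /= invfM mulrACA divff ?gt_eqF // mul1r.
apply: le_ereal_inf_tmp => _ [C C_id <-].
set K := Num.ceil _; have K_ge0 : 0 <= K.
  by rewrite ceil_ge0 (lt_le_trans (ltrN10 _)) // divr_ge0 // ln_ge0 ?ler1n //; lia.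
(* [density_ge] takes a natural number, so the nonnegative integer [K] is replaced by its absolute
   value. *)
rewrite -[K]gez0_abs //; apply: density_ge => v.
rewrite -lez_nat gez0_abs // ceil_log2_le //.
exact: identifying_hits (@annulus_row_onto d r) C_id.
Qed.
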